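(* Let $X,Y$ be compact metric spaces, let $f_{0,\infty}=\{f_n\}_{n=0}^\infty$ and $g_{0,\infty}=\{g_n\}_{n=0}^\infty$ be sequences of continuous self-maps of $X$ and $Y$ respectively, and let $h_n:X\to Y$ be a continuous map for each $n\ge0$. Then $(X,f_{0,\infty})$ is $\{h_n\}_{n=0}^\infty$-equi-conjugate to $(Y,g_{0,\infty})$ if and only if $(\mathcal{M}(X),\hat f_{0,\infty})$ is $\{\hat h_n\}_{n=0}^\infty$-equi-conjugate to $(\mathcal{M}(Y),\hat g_{0,\infty})$.
   Context: For a compact metric space $(X,d)$, $\mathcal{M}(X)$ is the space of all Borel probability measures on $X$ with the Prohorov metric $\mathcal{P}_d(\mu,\nu)=\inf\{\epsilon>0:\mu(A)\le\nu(A^\epsilon)+\epsilon \text{ and } \nu(A)\le\mu(A^\epsilon)+\epsilon \text{ for all Borel } A\subset X\}$, where $A^\epsilon=\{x\in X: d(x,A)<\epsilon\}$; its topology is the weak$^*$-topology and $\mathcal{M}(X)$ is a compact metric space. A continuous map $h:X\to Y$ between compact metric spaces induces $\hat h:\mathcal{M}(X)\to\mathcal{M}(Y)$, $\hat h(\mu)(B)=\mu(h^{-1}(B))$ for Borel $B\subset Y$. The system $(\mathcal{M}(X),\hat f_{0,\infty})$ is given by the maps $\hat f_{0,\infty}=\{\hat f_n\}_{n=0}^\infty$, and similarly for $\hat g_{0,\infty}$. $(X,f_{0,\infty})$ is $\{h_n\}_{n=0}^\infty$-equi-conjugate to $(Y,g_{0,\infty})$ if the maps $h_n:X\to Y$ are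 surjective, invertible, both families $\{h_n\}_{n=0}^\infty$ and $\{h_n^{-1}\}_{n=0}^\infty$ are (uniformly) equi-continuous, and $h_{n+1}\circ f_n=g_n\circ h_n$ for all $n\ge0$. A family $\{h_n\}_{n=0}^\infty$ of maps from $(X,d)$ to $(Y,\rho)$ is equi-continuous if for every $\epsilon>0$ there is $\delta>0$ such that $d(x,y)<\delta$ implies $\rho(h_n(x),h_n(y))<\epsilon$ for all $n\ge0$ and $x,y\in X$. *)

(* Defs.v *)
From HB Require Import structures.
From mathcomp Require Import all_boot all_order all_algebra.
From mathcomp Require Import all_classical all_reals all_analysis.

Set Implicit Arguments.
Unset Strict Implicit.
Unset Printing Implicit Defensive.

Import Order.TTheory GRing.Theory Num.Theory.
Import numFieldNormedType.Exports.

Local Open Scope classical_set_scope.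
Local Open Scope ring_scope.

(* The point expresses non-emptiness; it is required by [measurableType]. *)
#[short(type="pmetricType")]
HB.structure Definition PointedMetric (R : numDomainType) :=
  {T of Pointed T & Metric R T}.

Definition equi_continuous (R : realType) (X Y : metricType R)
    (h : nat -> X -> Y) :=
  forall e : R, 0 < e -> exists2 d : R, 0 < d &
    forall n x y, mdist x y < d -> mdist (h n x) (h n y) < e.

Definition equi_conjugate (R : realType) (X Y : metricType R)
    (f : nat -> X -> X) (g : nat -> Y -> Y) (h : nat -> X -> Y) :=
  exists k : nat -> Y -> X,
    [/\ forall n, range (h n) = [set: Y],
        forall n, cancel (h n) (k n) /\ cancel (k n) (h n),
        equi_continuous h,
        equi_continuous k
      & forall n, h n.+1 \o f n = g n \o h n].

Notation borel X := (g_sigma_algebraType (@open X)).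

Section neighborhood.
Context {R : realType} {X : metricType R}.
Implicit Types (A : set X) (x : X) (e : R).

(* Extended-real valued, so that the distance to the empty set is +oo. *)
Definition dist_set x A : \bar R := ereal_inf [set (mdist x a)%:E | a in A].

Definition nbh A e : set X := [set x | (dist_set x A < e%:E)%E].

Lemma nbhP A e x : nbh A e x <-> exists2 a, A a & mdist x a < e.
Proof.
split.
  by move=> /ereal_inf_lt[_ [a Aa <-]]; rewrite lte_fin => xa; exists a.
move=> [a Aa xa]; rewrite /nbh/= (@le_lt_trans _ _ (mdist x a)%:E)//.
by apply: ereal_inf_lbound; exists a.
Qed.

Lemma nbhE A e : nbh A e = \bigcup_(a in A) ball a e.
Proof.
apply/seteqP; split=> [x /nbhP[a Aa xa]|x [a Aa]].
  by exists a => //; rewrite ballEmdist/= metric_sym.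
by rewrite ballEmdist/= metric_sym => xa; apply/nbhP; exists a.
Qed.

Lemma open_nbh A e : open (nbh A e).
Proof.
rewrite nbhE; apply: bigcup_open => a _; rewrite openE => x.
rewrite ballEmdist/= => ax.
apply/nbhs_ballP; exists (e - mdist a x) => /=; first by rewrite subr_gt0.
move=> y; rewrite ballEmdist/= => xy.
by rewrite (le_lt_trans (metric_triangle a x y))// -ltrBrDl.
Qed.

Lemma sub_nbh A e : 0 < e -> A `<=` nbh A e.
Proof. by move=> e0 x Ax; apply/nbhP; exists x => //; rewrite mdistxx. Qed.

Lemma nbh_le A e e' : e <= e' -> nbh A e `<=` nbh A e'.
Proof.
move=> ee' x /nbhP[a Aa xa]; apply/nbhP; exists a => //.
exact: lt_le_trans ee'.
Qed.

Lemma nbh_nbh A e e' : nbh (nbh A e) e' `<=` nbh A (e + e').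
Proof.
move=> x /nbhP[y /nbhP[a Aa ya] xy]; apply/nbhP; exists a => //.
by rewrite (le_lt_trans (metric_triangle x y a))// addrC ltrD.
Qed.

Lemma bigcap_nbh A : closed A -> \bigcap_n nbh A n.+1%:R^-1 = A.
Proof.
move=> cA; apply/seteqP; split=> [x Ax|x Ax n _]; last exact: sub_nbh.
apply: cA => B /nbhs_ballP[r /= r0 xrB].
have [n nr] : exists n, n.+1%:R^-1 < r.
  exists (Num.truncn r^-1); rewrite -[ltRHS]invrK ltf_pV2 ?posrE ?invr_gt0//.
  exact: truncnS_gt.
have /nbhP[a Aa xa] := Ax n I.
by exists a; split => //; apply: xrB; rewrite ballEmdist/= (lt_trans xa).
Qed.

End neighborhood.

Section borel_probability.
Context {R : realType}.

(* A [probability] takes values on arbitrary sets, and equality of two of them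
   compares also the values on non-Borel sets; these are set to 0 so that the
   elements are determined by their values on Borel sets. *)
Record borel_prob (X : pmetricType R) := BorelProb {
  bprob :> probability (borel X) R ;
  bprob_out : forall A : set (borel X), ~ measurable A -> bprob A = 0%E
}.

HB.instance Definition _ (X : pmetricType R) := gen_eqMixin (borel_prob X).
HB.instance Definition _ (X : pmetricType R) := gen_choiceMixin (borel_prob X).

Lemma eq_probability d (T : measurableType d) (P Q : probability T R) :
  (P : set T -> \bar R) = Q -> P = Q.
Proof.
case: P Q => [p cp] [q cq] /= pq; rewrite pq in cp *; congr Probability.Pack.
case: cp cq => [[a0 a1] [b] [c] [d0] [e] [k] [l]].
case=> [[a0' a1'] [b'] [c'] [d0'] [e'] [k'] [l']].
rewrite (Prop_irrelevance a0' a0) (Prop_irrelevance a1' a1).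
rewrite (Prop_irrelevance b' b) (Prop_irrelevance c' c).
rewrite (Prop_irrelevance d0' d0) (Prop_irrelevance e' e).
by rewrite (Prop_irrelevance k' k) (Prop_irrelevance l' l).
Qed.

Lemma borel_prob_eq (X : pmetricType R) (mu nu : borel_prob X) :
  (forall A : set (borel X), measurable A -> mu A = nu A) -> mu = nu.
Proof.
move=> munu; have : bprob mu = bprob nu.
  apply: eq_probability; apply/funext => A.
  have [mA|mA] := pselect (measurable A); first exact: munu.
  by rewrite !bprob_out.
case: mu nu {munu} => [p ap] [q aq] /= pq; rewrite pq in ap *.
by congr BorelProb; exact: Prop_irrelevance.
Qed.


End borel_probability.

Section prohorov.
Local Open Scope ereal_scope.
Context {R : realType} {X : pmetricType R}.
Implicit Types (mu nu la : borel_prob X) (A : set (borel X)) (e : R).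

Definition prohorov_set mu nu : set R :=
  [set e : R | (0 < e)%R /\ forall A, measurable A ->
    mu A <= nu (nbh A e) + e%:E /\ nu A <= mu (nbh A e) + e%:E].

Definition prohorov mu nu : R := inf (prohorov_set mu nu).

Lemma measurable_nbh A e : measurable (nbh A e : set (borel X)).
Proof. by apply: sub_sigma_algebra; exact: open_nbh. Qed.

Lemma prohorov_has_inf mu nu : has_inf (prohorov_set mu nu).
Proof.
split; last by exists 0%R => e [/ltW].
exists 1%R; split => // A mA; split.
- by rewrite (le_trans (probability_le1 _ mA))// leeDr.
- by rewrite (le_trans (probability_le1 _ mA))// leeDr.
Qed.

Lemma prohorov_lt mu nu e : (prohorov mu nu < e)%R -> prohorov_set mu nu e.
Proof.
have [ne _] := prohorov_has_inf mu nu.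
move=> /(inf_lt ne)[d [d0 dmunu] de].
have le_nbh (la : borel_prob X) A : la (nbh A d) + d%:E <= la (nbh A e) + e%:E.
  rewrite leeD ?lee_fin//; last exact: ltW.
  by rewrite le_measure// ?inE; [exact: measurable_nbh..|
    exact/nbh_le/ltW].
split; first exact: lt_trans de.
by move=> A mA; have [h1 h2] := dmunu _ mA; split; apply: le_trans (le_nbh _ _).
Qed.

Lemma prohorovxx mu : prohorov mu mu = 0%R.
Proof.
apply/eqP; rewrite eq_le; apply/andP; split; last first.
  by apply: lb_le_inf; [case: (prohorov_has_inf mu mu)|move=> e [/ltW]].
apply/ler_addgt0Pl => e e0; rewrite addr0.
apply: ge_inf; first by case: (prohorov_has_inf mu mu).
split=> // A mA; have : mu A <= mu (nbh A e) + e%:E.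
  rewrite -[leLHS]adde0 leeD ?lee_fin//; last exact: ltW.
  by rewrite le_measure// ?inE//; [exact: measurable_nbh|exact: sub_nbh].
by [].
Qed.

Lemma prohorov_sym mu nu : prohorov mu nu = prohorov nu mu.
Proof.
rewrite /prohorov; congr inf; apply/seteqP.
by split=> e [e0 h]; split => // A mA; have [] := h _ mA.
Qed.

Lemma prohorov_triangle nu mu la :
  (prohorov mu la <= prohorov mu nu + prohorov nu la)%R.
Proof.
apply/ler_addgt0Pr => e e0.
have e20 : (0 < e / 2)%R by rewrite divr_gt0.
have [a0 ha] : prohorov_set mu nu (prohorov mu nu + e / 2)%R.
  by apply: prohorov_lt; rewrite ltrDl.
have [b0 hb] : prohorov_set nu la (prohorov nu la + e / 2)%R.
  by apply: prohorov_lt; rewrite ltrDl.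
set a := (prohorov mu nu + e / 2)%R in a0 ha.
set b := (prohorov nu la + e / 2)%R in b0 hb.
have -> : (prohorov mu nu + prohorov nu la + e = a + b)%R.
  by rewrite addrACA -splitr.
have nbh2 (l : borel_prob X) A c d : l (nbh (nbh A c) d) <= l (nbh A (c + d)).
  by rewrite le_measure// ?inE; [exact: measurable_nbh..|exact: nbh_nbh].
apply: ge_inf; first by case: (prohorov_has_inf mu la).
split; first exact: addr_gt0.
move=> A mA; split.
- have [h1 _] := ha _ mA; have [h2 _] := hb _ (measurable_nbh A a).
  have h3 := le_trans h2 (leeD2r b%:E (nbh2 la A a b)).
  apply: (le_trans h1); apply: (le_trans (leeD2r a%:E h3)).
  by rewrite -addeA -EFinD [X in X%:E]addrC.
- have [_ h1] := hb _ mA; have [_ h2] := ha _ (measurable_nbh A b).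
  have h3 := le_trans h2 (leeD2r a%:E (nbh2 mu A b a)).
  apply: (le_trans h1); apply: (le_trans (leeD2r b%:E h3)).
  by rewrite -addeA -EFinD [X in nbh _ X]addrC.
Qed.

Lemma prohorov0_closed mu nu A : prohorov mu nu = 0%R -> closed (A : set X) ->
  mu A <= nu A.
Proof.
move=> munu0 cA.
have mA : measurable A.
  rewrite -(setCK A); apply: measurableC; apply: sub_sigma_algebra.
  exact: closed_openC.
pose F n : set (borel X) := nbh (A : set X) n.+1%:R^-1.
have capF : \bigcap_n F n = A by exact: bigcap_nbh.
have cvgF : nu \o F @ \oo --> nu A.
  rewrite -[X in nu X]capF; apply: nonincreasing_cvg_mu.
  - by rewrite ltey_eq fin_num_measure//; exact: measurable_nbh.
  - by move=> n; exact: measurable_nbh.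
  - by rewrite capF.
  - move=> m n mn; apply/subsetPset; apply: nbh_le.
    by rewrite lef_pV2 ?posrE// ler_nat.
have cvg1 : (fun n => n.+1%:R^-1%:E : \bar R) @ \oo --> 0%:E.
  by apply/cvg_EFin; [near=> n|exact: cvg_harmonic].
have -> : nu A = nu A + 0%:E by rewrite adde0.
have : (fun n => nu (F n) + n.+1%:R^-1%:E) @ \oo --> nu A + 0%:E.
  by apply: cvgeD => //; rewrite adde_defC fin_num_adde_defr.
move=> /[dup] cvgD /cvg_lim <-//; apply: lime_ge.
  by apply/cvg_ex; exists (nu A + 0%:E).
apply: nearW => n.
have [_ /(_ _ mA)[]//] : prohorov_set mu nu (n.+1%:R^-1)%R.
  by apply: prohorov_lt; rewrite munu0 invr_gt0.
Unshelve. all: by end_near. Qed.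

Lemma prohorov_positivity mu nu : prohorov mu nu = 0%R -> mu = nu.
Proof.
move=> munu0; apply: borel_prob_eq => A mA.
have cover : \bigcup_(k in [set: nat]) (setT : set (borel X)) = setT.
  by rewrite bigcup_const//; exists 0%N.
have eq_open (U : set (borel X)) : open (U : set X) -> mu U = nu U.
  move=> oU; have mU : measurable U.
    exact: sub_sigma_algebra.
  have mCU : measurable (~` U) by exact: measurableC.
  have cU : closed (~` U : set X) by exact: open_closedC.
  have e : mu (~` U) = nu (~` U).
    apply/eqP; rewrite eq_le; apply/andP; split; apply: prohorov0_closed => //.
    by rewrite prohorov_sym.
  by rewrite -(setCK U) (probability_setC mu mCU) (probability_setC nu mCU) e.
have op (k : nat) : open (setT : set X) by exact: openT.
have Tfin (k : nat) : bprob mu setT < +oo by rewrite ltey_eq fin_num_measure.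
have sub : (@open X : set (set (borel X))) `<=` measurable.
  exact: sub_sigma_algebra.
exact: (@g_sigma_algebra_measure_unique _ R (borel X) (@open X) sub _ op cover
  (bprob mu) (bprob nu) (@openI X) eq_open Tfin A mA).
Qed.

HB.instance Definition _ := isMetric.Build R (borel_prob X)
  prohorovxx prohorov_positivity prohorov_sym prohorov_triangle.

Lemma borel_prob_mdistE mu nu : mdist mu nu = prohorov mu nu.
Proof. by []. Qed.

End prohorov.

Section trim.
Local Open Scope ereal_scope.
Context d (T : measurableType d) (R : realType).
Variable P : probability T R.

Definition trim (A : set T) : \bar R := if `[< measurable A >] then P A else 0.

Lemma trim_out A : ~ measurable A -> trim A = 0.
Proof. by move=> mA; rewrite /trim asboolF. Qed.

Lemma trimE A : measurable A -> trim A = P A.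
Proof. by move=> mA; rewrite /trim asboolT. Qed.

Let trim0 : trim set0 = 0.
Proof. by rewrite trimE// measure0. Qed.

Let trim_ge0 A : 0 <= trim A.
Proof. by rewrite /trim; case: ifPn. Qed.

Let trim_sigma_additive : semi_sigma_additive trim.
Proof.
move=> F mF tF mUF; rewrite trimE//.
under eq_fun do under eq_bigr do rewrite trimE//.
exact: measure_semi_sigma_additive.
Qed.

HB.instance Definition _ := isMeasure.Build _ _ _ trim
  trim0 trim_ge0 trim_sigma_additive.

Let trim_setT : trim setT = 1.
Proof. by rewrite trimE// probability_setT. Qed.

HB.instance Definition _ := Measure_isProbability.Build _ _ _ trim trim_setT.

End trim.

Section push_map.
Context {R : realType} {X Y : pmetricType R}.

Definition borel_fun (h : continuousType X Y) : borel X -> borel Y := h.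

Lemma measurable_borel_fun (h : continuousType X Y) :
  measurable_fun [set: borel X] (borel_fun h).
Proof.
apply: (@measurability _ _ (borel X) (borel Y) setT (borel_fun h) (@open Y)).
  by [].
move=> _ [B oB <-]; rewrite setTI; apply: sub_sigma_algebra.
by apply: open_comp oB => x _; exact: cts_fun.
Qed.

HB.instance Definition _ (h : continuousType X Y) :=
  isMeasurableFun.Build _ _ _ _ (borel_fun h) (measurable_borel_fun h).

Definition induced_map (h : continuousType X Y) (mu : borel_prob X) :
    borel_prob Y :=
  @BorelProb R Y (trim (distribution mu (borel_fun h))) (@trim_out _ _ _ _).

Lemma induced_mapE (h : continuousType X Y) (mu : borel_prob X)
    (B : set (borel Y)) :
  measurable B -> induced_map h mu B = mu (h @^-1` B).
Proof. by move=> mB; rewrite /= trimE. Qed.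

End push_map.

(* Main.v *)
(** The point mass embedding [x |-> delta_x] intertwines [h] with [h^], and the
    Prohorov distance of [delta_x] and [delta_y] is [min(d(x, y), 1)]; hence an
    equi-conjugacy of the spaces of measures restricts to one of the base spaces.
    Conversely, a uniform modulus of continuity of [h_n] is one of [h^_n], since
    the [d]-neighborhood of [h^-1(A)] lies in
    the preimage of the [e]-neighborhood of [A]. *)
From HB Require Import structures.
Require Import Defs.
From mathcomp Require Import all_boot all_order all_algebra.
From mathcomp Require Import all_classical all_reals all_analysis.
Import Order.TTheory GRing.Theory Num.Theory.
Local Open Scope classical_set_scope.
Local Open Scope ring_scope.

Lemma equi_continuous_continuous {R : realType} {X Y : metricType R}
    (h : nat -> X -> Y) n :
  equi_continuous h -> continuous (h n).
Proof.
move=> eh x; apply/cvg_ballP => e e0.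
have [d d0 hd] := eh _ e0.
apply/nbhs_ballP; exists d => // y; rewrite !ballEmdist/=; exact: hd.
Qed.

Section point_mass.
Context {R : realType} {X : pmetricType R}.
Implicit Types (x y : X) (e : R).

(** [trim] makes the Dirac measure vanish on non-Borel sets, as [bprob_out] demands. *)
Definition point_mass x : borel_prob X :=
  @BorelProb R X (trim (@dirac _ (borel X) x R)) (@trim_out _ _ _ _).

Lemma point_massE x (A : set (borel X)) :
  measurable A -> point_mass x A = \d_(x : borel X) A.
Proof. by move=> mA; rewrite /= trimE. Qed.

Lemma measurable_point x : measurable ([set x] : set (borel X)).
Proof.
rewrite -[X in measurable X]setCK; apply: measurableC; apply: sub_sigma_algebra.
apply: closed_openC; apply: accessible_closed_set1.
exact/hausdorff_accessible/metric_hausdorff.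
Qed.

Lemma prohorov_point_mass_le {x y e} :
  mdist x y < e -> prohorov (point_mass x) (point_mass y) <= e.
Proof.
move=> xye; have e0 : 0 < e by apply: le_lt_trans xye; exact: mdist_ge0.
apply: ge_inf; first by case: (prohorov_has_inf (point_mass x) (point_mass y)).
split=> // A mA.
suff dirac_le u v : mdist u v < e ->
    (point_mass u A <= point_mass v (nbh (A : set X) e) + e%:E)%E.
  by split; apply: dirac_le; rewrite // metric_sym.
move=> uve; rewrite !point_massE//; last exact: measurable_nbh.
rewrite !diracE; have [uA|_] := boolP (u \in A).
  rewrite mem_set ?leeDl ?lee_fin ?(ltW e0)//.
  by apply/nbhP; exists u; [exact/set_mem|rewrite metric_sym].
by rewrite adde_ge0// lee_fin// ltW.
Qed.

(** Test some admissible [r < e] on the Borel set [[set x]]: were [y] outside its [r]-neighborhood,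
    the inequality would read [1 <= 0 + r], against [r < e <= 1]. *)
Lemma prohorov_point_mass_lt {x y e} : e <= 1 ->
  prohorov (point_mass x) (point_mass y) < e -> mdist x y < e.
Proof.
move=> e1 /[dup] /inf_lt -/(_ (prohorov_has_inf _ _).1) [r [r0 hr] re] _.
have [+ _] := hr _ (measurable_point x).
rewrite !point_massE; [|exact: measurable_nbh|exact: measurable_point].
rewrite !diracE mem_set//; have [|_] := boolP (y \in _).
  move=> /set_mem /nbhP[_ -> yx] _.
  by rewrite metric_sym (lt_trans yx).
by rewrite add0e lee_fin => /(lt_le_trans (lt_le_trans re e1)); rewrite ltxx.
Qed.

Lemma point_mass_inj : injective point_mass.
Proof.
move=> x y xy; have : point_mass x [set x] = point_mass y [set x] by rewrite xy.
rewrite !point_massE; [|exact: measurable_point..].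
rewrite !diracE mem_set//; have [/set_mem ->//|_] := boolP (y \in _).
by move=> /eqP; rewrite eqe oner_eq0.
Qed.

End point_mass.

Section induced_map.
Context {R : realType}.

Lemma preimage_measurable {X Y : pmetricType R} (h : continuousType X Y)
    (B : set (borel Y)) :
  measurable B -> measurable (h @^-1` B : set (borel X)).
Proof.
by move=> mB; rewrite -[X in measurable X]setTI; exact: measurable_borel_fun.
Qed.

(** Functoriality, phrased for commuting squares so that no composite has to be bundled as a
    [continuousType]. *)
Lemma induced_map_comp (X Y Z W : pmetricType R) (a : continuousType X Y)
    (b : continuousType Y Z) (c : continuousType X W) (d : continuousType W Z) :
  b \o a = d \o c ->
  induced_map b \o induced_map a = induced_map d \o induced_map c.
Proof.
move=> bdac; apply/funext => mu; apply: borel_prob_eq => B mB.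
rewrite -[LHS]/(induced_map b (induced_map a mu) B).
rewrite -[RHS]/(induced_map d (induced_map c mu) B) !induced_mapE//; [|exact: preimage_measurable..].
by congr (mu _); rewrite -[LHS]/((b \o a) @^-1` B) bdac.
Qed.

Lemma induced_mapK {X Y : pmetricType R} (h : continuousType X Y)
    (k : continuousType Y X) :
  cancel h k -> cancel (induced_map h) (induced_map k).
Proof.
move=> hK mu; apply: borel_prob_eq => B mB.
rewrite !induced_mapE//; last exact: preimage_measurable.
by congr (mu _); apply/funext => x; rewrite /preimage/= hK.
Qed.

Lemma induced_map_point_mass {X Y : pmetricType R} (h : continuousType X Y) x :
  induced_map h (point_mass x) = point_mass (h x).
Proof.
apply: borel_prob_eq => B mB; rewrite induced_mapE// !point_massE//.
exact: preimage_measurable.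
Qed.

Lemma equi_continuous_induced_map {X Y : pmetricType R}
    (h : nat -> continuousType X Y) :
  equi_continuous (fun n => h n : X -> Y) ->
  equi_continuous (fun n => induced_map (h n)).
Proof.
move=> eh e e0; have e20 : 0 < e / 2 by rewrite divr_gt0.
have [d d0 hd] := eh _ e20.
(* [d] controls the neighborhoods and [e / 2] the additive term. Halving [e] restores strictness, as
   an element of [prohorov_set] bounds the infimum only weakly. *)
exists (Num.min d (e / 2)); first by rewrite lt_min d0.
move=> n mu nu /prohorov_lt[_ munu].
set r := Num.min _ _ in munu.
rewrite borel_prob_mdistE (@le_lt_trans _ _ (e / 2))//; last first.
  by rewrite ltr_pdivrMr// mulr2n mulrDr mulr1 ltrDl.
apply: ge_inf; first by case: (prohorov_has_inf (induced_map (h n) mu)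
  (induced_map (h n) nu)).
split=> // B mB.
have mh := preimage_measurable (h n).
have nbh_le (la : borel_prob X) :
    (la (nbh (h n @^-1` B : set X) r) + r%:E <=
     la (h n @^-1` nbh (B : set Y) (e / 2)) + (e / 2)%:E)%E.
  rewrite leeD ?lee_fin ?ge_min ?lexx ?orbT//.
  apply: le_measure; rewrite ?inE; [exact: measurable_nbh| |].
    by apply: mh; exact: measurable_nbh.
  move=> x /nbhP[a Ba xa]; apply/nbhP; exists (h n a) => //.
  by apply: hd; rewrite (lt_le_trans xa)// ge_min lexx.
have [h1 h2] := munu _ (mh _ mB).
rewrite !induced_mapE//; [|exact: measurable_nbh..].
by split; [exact: le_trans h1 _|exact: le_trans h2 _].
Qed.

End induced_map.

Theorem theorem5p4 (R : realType) (X Y : pmetricType R)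
  (cX : compact [set: X]) (cY : compact [set: Y])
  (f : nat -> continuousType X X) (g : nat -> continuousType Y Y)
  (h : nat -> continuousType X Y) :
  equi_conjugate f g h <->
  equi_conjugate (fun n => induced_map (f n)) (fun n => induced_map (g n))
    (fun n => induced_map (h n)).
Proof.
split=> [[k [_ hk eh ek hfg]]|[K [hT hK eh eK hfg]]].
  (* The inverses come as bare functions; bundled with their continuity, they induce the inverses on
     measures. *)
  have ck n : continuous (k n) by exact: equi_continuous_continuous.
  pose kc n : continuousType Y X :=
    HB.pack (k n) (isContinuous.Build _ _ (k n) (ck n)).
  have hK n : cancel (induced_map (h n)) (induced_map (kc n)) /\
      cancel (induced_map (kc n)) (induced_map (h n)).
    by have [hk1 kh1] := hk n; split; exact: induced_mapK.
  exists (fun n => induced_map (kc n)); split=> //.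
  - by move=> n; apply/seteqP; split=> // nu _;
      exists (induced_map (kc n) nu) => //; exact: (hK n).2.
  - exact: equi_continuous_induced_map.
  - exact: equi_continuous_induced_map.
  - by move=> n; exact: induced_map_comp.
(* If [y] had no preimage, the image under [induced_map (h n)] of [K n (point_mass y)] would give
   [[set y]] mass 0; but that image is [point_mass y]. Pairing [n] with [y] lets one choice serve
   all [n]. *)
have surj (ny : nat * Y) : exists x, h ny.1 x = ny.2.
  case: ny => n y /=; apply: contrapT => nxy.
  have := congr1 (fun mu : borel_prob Y => mu [set y]) ((hK n).2 (point_mass y)).
  have mY := measurable_point y.
  rewrite induced_mapE// point_massE// diracE mem_set//.
  have -> : h n @^-1` [set y] = set0.
    by apply/seteqP; split=> // x hxy; apply: nxy; exists x.
  by rewrite measure0 => /esym/eqP; rewrite eqe oner_eq0.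
have [k0 k0P] := choice surj.
pose k n y := k0 (n, y).
have kh n : cancel (k n) (h n) by move=> y; exact: (k0P (n, y)).
have hinj n : injective (h n).
  move=> x y hxy; apply: point_mass_inj; apply: (can_inj (hK n).1).
  by rewrite !induced_map_point_mass hxy.
(* [K n] is an arbitrary inverse, not given as an induced map; it preserves point masses because
   [point_mass y] is the image of [point_mass (k n y)]. *)
have KE n y : K n (point_mass y) = point_mass (k n y).
  by rewrite -{1}(kh n y) -induced_map_point_mass (hK n).1.
have restrict (Z W : pmetricType R) (a : nat -> Z -> W)
    (A : nat -> borel_prob Z -> borel_prob W) :
    (forall n z, A n (point_mass z) = point_mass (a n z)) ->
    equi_continuous A -> equi_continuous a.
  move=> AE eA e e0.
  (* The cap at 1 is needed because the Prohorov distance of point masses recovers only distances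
     below 1. *)
  have [|d d0 hd] := eA (Num.min e 1); first by rewrite lt_min e0 ltr01.
  (* Half of [d], since [prohorov_point_mass_le] yields a weak bound where [hd] wants a strict
     one. *)
  exists (d / 2); first by rewrite divr_gt0.
  move=> n x y xyd; apply: (@lt_le_trans _ _ (Num.min e 1)); last first.
    by rewrite ge_min lexx.
  apply: prohorov_point_mass_lt; first by rewrite ge_min lexx orbT.
  rewrite -!AE; apply: hd; apply: le_lt_trans (prohorov_point_mass_le xyd) _.
  by rewrite ltr_pdivrMr// mulr2n mulrDr mulr1 ltrDl.
exists k; split.
- by move=> n; apply/seteqP; split=> // y _; exists (k n y); [|exact: kh].
- by move=> n; split=> // x; apply: (hinj n); rewrite kh.
- by apply: restrict eh => n x; exact: induced_map_point_mass.
- exact: restrict eK.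
(* The square on measures, evaluated at [point_mass x], is the square on points. *)
- move=> n; apply/funext => x; apply: point_mass_inj.
  rewrite /= -!induced_map_point_mass.
  exact: (congr1 (fun F => F (point_mass x)) (hfg n)).
Qed.
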